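(* Let $M,N$ be positive integers, $h\in\mathbb{C}$, and let $\boldsymbol z=(z_1,\dots,z_N)$, $\boldsymbol\lambda=(\lambda_1,\dots,\lambda_M)$ be sequences of complex numbers. In the algebra $\mathcal{A}_h$, let $G_h$ be the $M\times M$ matrix $$G_h=\Big((p_u-\lambda_i)\,\delta_{ij}-\sum_{a=1}^N\frac{x_{ja}\,p_{ia}}{u-z_a}\Big)_{i,j=1}^M .$$ Then $$\prod_{a=1}^N(u-z_a)\ \mathrm{rdet}(G_h)=\sum_{A,B,\ |A|=|B|}(-1)^{|A|}\prod_{a\notin B}(u-z_a)\prod_{b\notin A}(p_u-\lambda_b)\ \det(x_{ab})_{a\in A}^{b\in B}\ \det(p_{ab})_{a\in A}^{b\in B},$$ where the sum is over all pairs of subsets $A\subset\{1,\dots,M\}$, $B\subset\{1,\dots,N\}$ of the same cardinality; in the products, $a\notin B$ means $a\in\{1,\dots,N\}\setminus B$ and $b\notin A$ means $b\in\{1,\dots,M\}\setminus A$. The sets $A,B$ inherit the natural orderings from $\{1,\dots,M\}$ and $\{1,\dots,N\}$, and these orderings determine the determinants in the formula.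
   Context: Row determinant: for an $n\times n$ matrix $A=(a_{ij})$ with entries in an associative (not necessarily commutative) algebra, $\mathrm{rdet}(A)=\sum_{\sigma\in S_n}\mathrm{sgn}(\sigma)\,a_{1\sigma(1)}a_{2\sigma(2)}\cdots a_{n\sigma(n)}$, where $\mathrm{sgn}(\sigma)=\pm1$ is the sign of $\sigma$. The algebra $\mathcal{A}_h$: consider variables $u,p_u,x_{ij},p_{ij}$ ($i=1,\dots,M$, $j=1,\dots,N$) such that the commutator of any two of them is zero except $[p_u,u]=h$ and $[p_{ij},x_{ij}]=h$ for all $i,j$. $\mathcal{A}_h$ is the associative unital $\mathbb{C}$-algebra whose elements are polynomials in $p_u,x_{ij},p_{ij}$ with coefficients that are rational functions in $u$ (so that $[p_u,f(u)]=h f'(u)$ for rational $f$, and rational functions of $u$ commute with all $x_{ij},p_{ij}$). All entries $x_{ab}$ commute with each other and all $p_{ab}$ commute with each other, so $\det(x_{ab})$ and $\det(p_{ab})$ are ordinary determinants; determinants of empty matrices and empty products equal $1$. *)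

(* Defs.v *)
From HB Require Import structures.
From mathcomp Require Import all_boot all_order all_fingroup all_algebra ring.
From mathcomp Require Import ssrcomplements mpoly generic_quotient.

Set Implicit Arguments.
Unset Strict Implicit.
Unset Printing Implicit Defensive.

Import GRing.Theory.
Local Open Scope ring_scope.
Local Open Scope quotient_scope.

Notation "x %:F" := (@FracField.tofrac _ x) : ring_scope.

Section QuotientRules.
Variables (K : fieldType) (a b c d a' b' c' d' : K).
Hypotheses (b0 : b != 0) (d0 : d != 0).

Lemma quotient_ruleD :
  ((a' * d + a * d' + (c' * b + c * b')) * (b * d)
   - (a * d + c * b) * (b' * d + b * d')) / (b * d) ^+ 2 =
  (a' * b - a * b') / b ^+ 2 + (c' * d - c * d') / d ^+ 2.
Proof. by field; rewrite b0 d0. Qed.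

Lemma quotient_ruleM :
  ((a' * c + a * c') * (b * d) - (a * c) * (b' * d + b * d')) / (b * d) ^+ 2 =
  (a' * b - a * b') / b ^+ 2 * (c / d) + (a / b) * ((c' * d - c * d') / d ^+ 2).
Proof. by field; rewrite b0 d0. Qed.
End QuotientRules.

Section RatDerivative.
Variable F : fieldType.
Local Notation K := {fraction {poly F}}.

(* Quotient rule on a chosen representative; independence of the choice is
   ratder_frac. *)
Definition ratder (f : K) : K :=
  let r := repr f in
  ((\n_r)^`() * \d_r - \n_r * (\d_r)^`())%:F / (\d_r ^+ 2)%:F.

Lemma ratder_frac (a b : {poly F}) : b != 0 ->
  ratder (a%:F / b%:F) = (a^`() * b - a * b^`())%:F / (b ^+ 2)%:F.
Proof.
move=> b0; rewrite /ratder.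
set r := repr _.
have d0 : \d_r != 0 by apply: denom_ratioP.
have e : (\n_r)%:F / (\d_r)%:F = a%:F / b%:F :> K.
  have -> : a%:F / b%:F = \pi_(K) r by rewrite /r reprK.
  rewrite -[in LHS]/(FracField.mul _ (FracField.inv _)) !piE.
  rewrite /FracField.mulf /FracField.invf !numden_Ratio ?oner_eq0 ?mulr1 ?mul1r //.
  by rewrite Ratio_numden.
have e' : \n_r * b = a * \d_r.
  apply/eqP; rewrite -tofrac_eq !tofracM; apply/eqP.
  by apply/eqP; rewrite -eqr_div ?tofrac_eq0 //; apply/eqP.
have e2 : (\n_r)^`() * b + \n_r * b^`() = a^`() * \d_r + a * (\d_r)^`().
  by rewrite -!derivM e'.
apply/eqP; rewrite eqr_div ?tofrac_eq0 ?expf_neq0 // -!tofracM tofrac_eq.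
rewrite -subr_eq0; apply/eqP.
transitivity (b * \d_r * ((\n_r)^`() * b + \n_r * b^`() - (a^`() * \d_r + a * (\d_r)^`()))
   - (\d_r * b^`() + b * (\d_r)^`()) * (\n_r * b - a * \d_r)).
  by ring.
by rewrite e2 e' !subrr !mulr0 subrr.
Qed.

Lemma fracP (f : K) : exists a b : {poly F}, b != 0 /\ f = a%:F / b%:F.
Proof.
exists (\n_(repr f)), (\d_(repr f)); split; first exact: denom_ratioP.
rewrite -[RHS]/(FracField.mul _ (FracField.inv _)) !piE.
rewrite /FracField.mulf /FracField.invf !numden_Ratio ?oner_eq0 ?mulr1 ?mul1r
  ?denom_ratioP //.
by rewrite Ratio_numden reprK.
Qed.

Lemma ratder_poly (a : {poly F}) : ratder a%:F = a^`()%:F.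
Proof.
rewrite -[a%:F]divr1 -tofrac1 ratder_frac ?oner_eq0 //.
by rewrite -[1]/(1%:P) derivC mulr0 subr0 mulr1 expr1n tofrac1 divr1.
Qed.

Lemma ratderD (f g : K) : ratder (f + g) = ratder f + ratder g.
Proof.
have [a [b [b0 ->]]] := fracP f; have [c [d [d0 ->]]] := fracP g.
have [B D] : b%:F != 0 :> K /\ d%:F != 0 :> K by rewrite !tofrac_eq0.
rewrite (ratder_frac a b0) (ratder_frac c d0) (addf_div _ _ B D).
rewrite -!tofracM -tofracD (ratder_frac _ (mulf_neq0 b0 d0)).
rewrite derivD !derivM !(tofracB, tofracD, tofracM, tofracXn).
exact: (quotient_ruleD a%:F c%:F (a^`())%:F (b^`())%:F (c^`())%:F
         (d^`())%:F B D).
Qed.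

Lemma ratderM (f g : K) : ratder (f * g) = ratder f * g + f * ratder g.
Proof.
have [a [b [b0 ->]]] := fracP f; have [c [d [d0 ->]]] := fracP g.
have [B D] : b%:F != 0 :> K /\ d%:F != 0 :> K by rewrite !tofrac_eq0.
rewrite (ratder_frac a b0) (ratder_frac c d0) mulf_div.
rewrite -!tofracM (ratder_frac _ (mulf_neq0 b0 d0)).
rewrite !derivM !(tofracB, tofracD, tofracM, tofracXn).
exact: (quotient_ruleM a%:F c%:F (a^`())%:F (b^`())%:F (c^`())%:F
         (d^`())%:F B D).
Qed.

Lemma ratderC (c : F) : ratder (c%:P)%:F = 0.
Proof. by rewrite ratder_poly derivC tofrac0. Qed.

End RatDerivative.

Fact ratder_zmod (F : fieldType) : zmod_morphism (@ratder F).
Proof.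
move=> f g; apply: (@addIr _ (ratder g)).
by rewrite -ratderD -[RHS]addrA addNr addr0 subrK.
Qed.

HB.instance Definition _ (F : fieldType) :=
  GRing.isZmodMorphism.Build {fraction {poly F}} {fraction {poly F}}
    (@ratder F) (@ratder_zmod F).

Section CoefficientwiseDerivation.
Variables (R : comNzRingType) (n : nat) (d : {additive R -> R}).
Hypothesis dM : forall a b, d (a * b) = d a * b + a * d b.

Lemma map_derZ c (p : {mpoly R[n]}) :
  map_mpoly d (c *: p) = d c *: p + c *: map_mpoly d p.
Proof.
by apply/mpolyP => m; rewrite mcoeffD !mcoeff_map_mpoly !mcoeffZ mcoeff_map_mpoly dM.
Qed.

Lemma map_derX m : map_mpoly d 'X_[m] = 0 :> {mpoly R[n]}.
Proof.
have d1 : d 1 = 0.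
  by apply: (@addrI _ (d 1)); rewrite addr0; have := dM 1 1; rewrite !mulr1 mul1r.
apply/mpolyP => m'; rewrite mcoeff_map_mpoly mcoeffX mcoeff0.
by case: eqP => _; rewrite ?mulr1n ?mulr0n ?d1 ?raddf0.
Qed.

Lemma map_derM (p q : {mpoly R[n]}) :
  map_mpoly d (p * q) = map_mpoly d p * q + p * map_mpoly d q.
Proof.
elim/mpolyind: p => [|a m p _ _ IHp]; first by rewrite !(mul0r, raddf0, addr0).
rewrite mulrDl !raddfD /= IHp !mulrDl addrACA; congr (_ + _).
elim/mpolyind: q {IHp} => [|b m' q _ _ IHq]; first by rewrite !(mulr0, raddf0, addr0).
rewrite mulrDr !raddfD /= IHq !mulrDr addrACA; congr (_ + _).
rewrite -scalerAl -scalerAr scalerA -mpolyXD !map_derZ !map_derX !scaler0 !addr0 dM.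
by rewrite -!scalerAl -!scalerAr !scalerA scalerDl mpolyXD.
Qed.
End CoefficientwiseDerivation.

Section LeftMultiplication.
Variables (R : comNzRingType) (n : nat) (D : 'I_n -> R -> R).
Local Notation V := {mpoly R[n]}.

(* {mpoly R[n]} is read as polynomials in momenta 'X_0, ..., 'X_(n-1) with
   coefficients in R written on the left.  opX k is left multiplication by 'X_k
   when ['X_k, r] = D k r for every coefficient r, since
   'X_k (r 'X_[m]) = r 'X_k 'X_[m] + D k r 'X_[m]. *)
Definition opX (k : 'I_n) (v : V) : V := 'X_k * v + map_mpoly (D k) v.

Hypothesis DD : forall k a b, D k (a + b) = D k a + D k b.
Hypothesis DM : forall k a b, D k (a * b) = D k a * b + a * D k b.
Hypothesis DC : forall k l a, D k (D l a) = D l (D k a).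

Lemma der0 k : D k 0 = 0.
Proof. by apply: (@addrI _ (D k 0)); rewrite -DD !addr0. Qed.

Lemma der1 k : D k 1 = 0.
Proof.
apply: (@addrI _ (D k 1)); rewrite addr0.
by have := DM k 1 1; rewrite !mulr1 mul1r.
Qed.

Fact der_zmod k : zmod_morphism (D k).
Proof.
move=> a b; apply: (@addIr _ (D k b)).
by rewrite -DD -[RHS]addrA addNr addr0 subrK.
Qed.

HB.instance Definition _ k := GRing.isZmodMorphism.Build R R (D k) (der_zmod k).

Lemma opXD k v w : opX k (v + w) = opX k v + opX k w.
Proof. by rewrite /opX mulrDr raddfD addrACA. Qed.

Lemma opX0 k : opX k 0 = 0.
Proof. by rewrite /opX mulr0 raddf0 addr0. Qed.

Lemma opXZ k r v : opX k (r *: v) = r *: opX k v + D k r *: v.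
Proof.
rewrite /opX -scalerAr scalerDr -addrA; congr (_ + _).
by apply/mpolyP => m; rewrite mcoeffD !mcoeffZ !mcoeff_map_mpoly mcoeffZ /= DM addrC.
Qed.

Lemma opX_mon k m : opX k 'X_[m] = 'X_[U_(k) + m].
Proof.
rewrite /opX -mpolyXD -[RHS]addr0; congr (_ + _); apply/mpolyP => m'.
rewrite mcoeff_map_mpoly mcoeffX mcoeff0.
by case: eqP => _ /=; rewrite ?mulr1n ?mulr0n ?der1 ?der0.
Qed.

End LeftMultiplication.

Section NormalOrdering.
Variables (R : comNzRingType) (n : nat) (opX : 'I_n -> {mpoly R[n]} -> {mpoly R[n]}).
Local Notation V := {mpoly R[n]}.

Definition opXm (m : 'X_{1..n}) (v : V) : V :=
  foldr (fun k => iter (m k) (opX k)) v (enum 'I_n).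

(* The product of normally ordered polynomials: each momentum of v acts on w. *)
Definition opmul (v w : V) : V := \sum_(m <- msupp v) v@_m *: opXm m w.

Variable D : 'I_n -> R -> R.
Hypothesis DC : forall k l a, D k (D l a) = D l (D k a).
Hypothesis opXD : forall k v w, opX k (v + w) = opX k v + opX k w.
Hypothesis opX0 : forall k, opX k 0 = 0.
Hypothesis opXZ : forall k r v, opX k (r *: v) = r *: opX k v + D k r *: v.
Hypothesis opX_mon : forall k m, opX k 'X_[m] = 'X_[U_(k) + m].

Lemma opX_comm k l v : opX k (opX l v) = opX l (opX k v).
Proof.
elim/mpolyind: v => [|c m v _ _ IHv]; first by rewrite !opX0.
rewrite !opXD IHv; congr (_ + _).
rewrite !(opXZ, opX_mon, opXD) DC !addmA [(U_(k) + U_(l))%MM]addmC.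
by rewrite -!addrA; congr (_ + _); rewrite !addrA; congr (_ + _); rewrite addrC.
Qed.

Lemma iter_opXD k i v w : iter i (opX k) (v + w) = iter i (opX k) v + iter i (opX k) w.
Proof. by elim: i => //= i ->; rewrite opXD. Qed.

Lemma opXmD m v w : opXm m (v + w) = opXm m v + opXm m w.
Proof. by rewrite /opXm; elim: (enum _) => //= k s ->; rewrite iter_opXD. Qed.

Lemma opX_iter k l i v : opX k (iter i (opX l) v) = iter i (opX l) (opX k v).
Proof. by elim: i => //= i <-; rewrite opX_comm. Qed.

Lemma opXmU k m v : opXm (U_(k) + m) v = opX k (opXm m v).
Proof.
rewrite /opXm; have: k \in enum 'I_n by rewrite mem_enum.
have: uniq (enum 'I_n) by apply: enum_uniq.
elim: (enum _) => //= l s IHs /andP[ls us]; rewrite inE mnmDE mnm1E.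
have [kl _|kl /= ks] := eqVneq k l.
  rewrite -{l}kl in ls *; rewrite iterS; congr (opX _ (iter _ _ _)).
  elim: s ls {us IHs} => //= l s IHs; rewrite inE negb_or => /andP[kl ks].
  by rewrite IHs // mnmDE mnm1E (negbTE kl).
by rewrite add0n IHs // opX_iter.
Qed.

Lemma opXm0 v : opXm 0%MM v = v.
Proof. by rewrite /opXm; elim: (enum _) => //= k s ->; rewrite mnmE. Qed.

Lemma mnmU_ind (P : 'X_{1..n} -> Prop) :
  P 0%MM -> (forall k m, P m -> P (U_(k) + m)%MM) -> forall m, P m.
Proof.
move=> P0 PU m; have [d] := ubnP (mdeg m); elim: d m => // d IHd m.
have [->|] := eqVneq m 0%MM => //.
case: (pickP (fun k => m k != 0%N)) => [k mk _|m0 /eqP[]]; last first.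
  by apply/mnmP => k; rewrite mnmE; apply/eqP; have /negbFE := m0 k.
have lekm : (U_(k) <= m)%MM by rewrite lep1mP.
rewrite -(submK lekm) addmC mdegD mdeg1 => lt_md.
by apply: PU; apply: IHd.
Qed.

Lemma opXm_mon1 m : opXm m 1 = 'X_[m].
Proof.
elim/mnmU_ind: m => [|k m IHm]; first by rewrite opXm0 mpolyX0.
by rewrite opXmU IHm opX_mon.
Qed.

Lemma opXm_mon m1 m2 : opXm m1 'X_[m2] = 'X_[m1 + m2].
Proof.
elim/mnmU_ind: m1 => [|k m IHm]; first by rewrite opXm0 add0m.
by rewrite opXmU IHm opX_mon addmA.
Qed.

Lemma opmulwE d (v w : V) : (msize v <= d)%N ->
  opmul v w = \sum_(m : 'X_{1..n < d}) v@_m *: opXm m w.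
Proof.
move=> le_vd; rewrite /opmul (big_mksub 'X_{1..n < d}) /=; first last.
  by move=> m /msize_mdeg_lt /leq_trans; apply.
  by rewrite msupp_uniq.
by rewrite big_rmcond //= => m /memN_msupp_eq0 ->; rewrite scale0r.
Qed.

Lemma opmulDl v1 v2 w : opmul (v1 + v2) w = opmul v1 w + opmul v2 w.
Proof.
pose k := maxn (msize (v1 + v2)) (maxn (msize v1) (msize v2)).
rewrite !(@opmulwE k) ?leq_max ?leqnn ?orbT // -big_split /=.
by apply: eq_bigr => m _; rewrite mcoeffD scalerDl.
Qed.

Lemma opmulDr v w1 w2 : opmul v (w1 + w2) = opmul v w1 + opmul v w2.
Proof.
by rewrite /opmul -big_split; apply: eq_bigr => m _; rewrite opXmD scalerDr.
Qed.

Lemma opmul0l w : opmul 0 w = 0.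
Proof. by rewrite /opmul msupp0 big_nil. Qed.

Lemma opmul_mon r m w : opmul (r *: 'X_[m]) w = r *: opXm m w.
Proof.
have [->|r0] := eqVneq r 0; first by rewrite !scale0r opmul0l.
rewrite (@opmulwE (mdeg m).+1); last first.
  by rewrite (leq_trans (msizeZ_le _ _)) // msizeX.
rewrite (bigD1 (BMultinom (ltnSn (mdeg m)))) //= mcoeffZ mcoeffX eqxx mulr1.
rewrite big1 ?addr0 // => m' /negbTE nm.
by rewrite mcoeffZ mcoeffX -[m == _]eq_sym -val_eqE /= in nm *; rewrite nm mulr0 scale0r.
Qed.

Lemma opmulZl r v w : opmul (r *: v) w = r *: opmul v w.
Proof.
elim/mpolyind: v => [|c m v _ _ IHv]; first by rewrite scaler0 opmul0l scaler0.
by rewrite scalerDr !opmulDl IHv scalerA !opmul_mon scalerDr scalerA.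
Qed.

Lemma opmul_opX k v w : opmul (opX k v) w = opX k (opmul v w).
Proof.
elim/mpolyind: v => [|c m v _ _ IHv]; first by rewrite opX0 !opmul0l opX0.
rewrite opXD !opmulDl IHv opXD; congr (_ + _).
by rewrite opXZ opmulDl opX_mon !opmul_mon opXmU opXZ.
Qed.

Lemma opmulA v w x : opmul v (opmul w x) = opmul (opmul v w) x.
Proof.
elim/mpolyind: v => [|c m v _ _ IHv]; first by rewrite !opmul0l.
rewrite !opmulDl IHv !opmul_mon opmulZl; congr (_ *: _ + _).
elim/mnmU_ind: m => [|k m IHm]; first by rewrite !opXm0.
by rewrite !opXmU opmul_opX IHm.
Qed.

Lemma opmulC r w : opmul r%:MP w = r *: w.
Proof. by rewrite -alg_mpolyC -[1]mpolyX0 opmul_mon opXm0. Qed.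

Lemma opmul1l w : opmul 1 w = w.
Proof. by rewrite -[1]/(1%:MP) opmulC scale1r. Qed.

Lemma opmul1r v : opmul v 1 = v.
Proof.
by rewrite [RHS]mpolyE; apply: eq_bigr => m _; rewrite opXm_mon1.
Qed.

Lemma opmulX k w : opmul 'X_k w = opX k w.
Proof. by rewrite -[X in opmul X _]scale1r opmul_mon scale1r -[U_(k)%MM]addm0 opXmU opXm0. Qed.

Lemma opmulZr r v w : (forall k, D k r = 0) -> opmul v (r *: w) = r *: opmul v w.
Proof.
move=> Dr; elim/mpolyind: v => [|c m v _ _ IHv]; first by rewrite !opmul0l scaler0.
have e : opXm m (r *: w) = r *: opXm m w.
  elim/mnmU_ind: m => [|k m IHm]; first by rewrite !opXm0.
  by rewrite !opXmU IHm opXZ Dr scale0r addr0.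
by rewrite !opmulDl IHv !opmul_mon e scalerDr !scalerA mulrC.
Qed.
End NormalOrdering.

(* The algebra A_h over F: polynomials in p_u, p_ij with coefficients in F(u)[x_ij]
   (u = 'X in {fraction {poly F}}).  The carrier does not mention h; the parameter
   selects the noncommutative product Ah_mul instead of that of {mpoly _}. *)
Definition Ah (F : fieldType) (M N : nat) (h : F) : Type :=
  {mpoly {mpoly {fraction {poly F}}[M * N]}[(M * N).+1]}.

Section Algebra.
Variables (F : fieldType) (M N : nat) (h : F).
Local Notation K := {fraction {poly F}}.

Local Notation Ahcoef := {mpoly K[M * N]}.

(* commp k r = [p_k, r], with p_0 = p_u and p_(lift ord0 (mxvec_index i j)) = p_ij,
   the variable x_ij of the coefficient ring being 'X_(mxvec_index i j):
   h d/du (coefficientwise) for p_u and h d/dx_ij for p_ij. *)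
Definition commp (k : 'I_(M * N).+1) (r : Ahcoef) : Ahcoef :=
  h%:P%:F *: (if unlift ord0 k is Some l then mderiv l r
              else map_mpoly (@ratder F) r).

Lemma commpD k a b : commp k (a + b) = commp k a + commp k b.
Proof.
rewrite /commp -scalerDr; congr (_ *: _).
by case: (unlift _ _) => [l|]; rewrite raddfD.
Qed.

Lemma commpM k a b : commp k (a * b) = commp k a * b + a * commp k b.
Proof.
rewrite /commp -scalerAl -scalerAr -scalerDr; congr (_ *: _).
by case: (unlift _ _) => [l|]; [exact: mderivM | exact/map_derM/ratderM].
Qed.
Lemma commpC k l a : commp k (commp l a) = commp l (commp k a).
Proof.
have dZ c (b : Ahcoef) : map_mpoly (@ratder F) (c%:P%:F *: b) = c%:P%:F *: map_mpoly (@ratder F) b.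
  by rewrite (map_derZ (@ratderM F)) /= ratderC scale0r add0r.
have dd (i : 'I_(M * N)) (b : Ahcoef) :
    map_mpoly (@ratder F) (mderiv i b) = mderiv i (map_mpoly (@ratder F) b).
  by apply/mpolyP => m; rewrite mcoeff_map_mpoly !mcoeff_mderiv mcoeff_map_mpoly raddfMn.
rewrite /commp; case: (unlift _ k) => [i|]; case: (unlift _ l) => [j|].
- by rewrite !mderivZ mderiv_comm.
- by rewrite mderivZ dZ dd.
- by rewrite dZ mderivZ dd.
- by [].
Qed.

Local Notation Ah := (Ah M N h).

Definition Ah_mul (v w : Ah) : Ah := opmul (opX commp) v w.

HB.instance Definition _ := GRing.Zmodule.on Ah.

Local Notation opXDc := (opXD commpD).
Local Notation opX0c := (opX0 commpD).
Local Notation opXZc := (opXZ commpD commpM).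
Local Notation opX_monc := (opX_mon commpD commpM).

Fact Ah_mulA : associative Ah_mul.
Proof. exact: (opmulA commpC opXDc opX0c opXZc opX_monc). Qed.

Fact Ah_mul1l : left_id (1 : {mpoly _[_]}) Ah_mul.
Proof. exact: opmul1l. Qed.

Fact Ah_mul1r : right_id (1 : {mpoly _[_]}) Ah_mul.
Proof. exact: (opmul1r commpC opXDc opX0c opXZc opX_monc). Qed.

Fact Ah_mulDl : left_distributive Ah_mul +%R.
Proof. exact: opmulDl. Qed.

Fact Ah_mulDr : right_distributive Ah_mul +%R.
Proof. move=> v w x; exact: (opmulDr opXDc). Qed.

Fact Ah_1_neq0 : (1 : {mpoly Ahcoef[(M * N).+1]}) != 0 :> Ah.
Proof. exact: oner_neq0. Qed.

HB.instance Definition _ := GRing.Zmodule_isNzRing.Build Ah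
  Ah_mulA Ah_mul1l Ah_mul1r Ah_mulDl Ah_mulDr Ah_1_neq0.

Definition Ah_coef (r : Ahcoef) : Ah := (r%:MP : {mpoly Ahcoef[(M * N).+1]}).
Definition Ah_mom (k : 'I_(M * N).+1) : Ah := ('X_k : {mpoly Ahcoef[(M * N).+1]}).

Lemma Ah_coefME r (v : Ah) :
  Ah_coef r * v = r *: (v : {mpoly Ahcoef[(M * N).+1]}).
Proof. exact: opmulC. Qed.

Lemma Ah_momME k (v : Ah) : Ah_mom k * v = opX commp k v.
Proof.
rewrite -[LHS]/(opmul (opX commp) 'X_k v).
by rewrite (opmulX commpC opXDc opX0c opXZc opX_monc).
Qed.

Fact Ah_coef_zmod : zmod_morphism Ah_coef.
Proof. exact: mpolyCB. Qed.

Fact Ah_coef_monoid : monoid_morphism Ah_coef.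
Proof.
split=> // r s; rewrite Ah_coefME /Ah_coef -mul_mpolyC; exact: mpolyCM.
Qed.

HB.instance Definition _ := GRing.isZmodMorphism.Build Ahcoef Ah Ah_coef Ah_coef_zmod.
HB.instance Definition _ :=
  GRing.isMonoidMorphism.Build Ahcoef Ah Ah_coef Ah_coef_monoid.

Lemma Ah_coef_inj : injective Ah_coef.
Proof. exact: (can_inj (@mpolyCK _ _)). Qed.

Lemma Ah_coefC r s : Ah_coef r * Ah_coef s = Ah_coef s * Ah_coef r.
Proof. by rewrite -!rmorphM mulrC. Qed.

Lemma Ah_momC k l : Ah_mom k * Ah_mom l = Ah_mom l * Ah_mom k.
Proof. by rewrite !Ah_momME /Ah_mom !opX_monc addmC. Qed.

Lemma Ah_mom_coef k r :
  Ah_mom k * Ah_coef r - Ah_coef r * Ah_mom k = Ah_coef (commp k r).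
Proof.
rewrite Ah_momME Ah_coefME /Ah_mom /Ah_coef -[r%:MP]alg_mpolyC -[1]mpolyX0.
by rewrite opXZc opX_monc addm0 addrC addKr mpolyX0 alg_mpolyC.
Qed.

Definition Ah_rat (f : K) : Ah := Ah_coef f%:MP.

Fact Ah_rat_zmod : zmod_morphism Ah_rat.
Proof. by move=> f g; rewrite /Ah_rat !rmorphB. Qed.

Fact Ah_rat_monoid : monoid_morphism Ah_rat.
Proof. by split=> [|f g]; rewrite /Ah_rat ?rmorphM ?rmorph1. Qed.

HB.instance Definition _ := GRing.isZmodMorphism.Build K Ah Ah_rat Ah_rat_zmod.
HB.instance Definition _ := GRing.isMonoidMorphism.Build K Ah Ah_rat Ah_rat_monoid.

Lemma commp_cst k (c : F) : commp k (c%:P%:F)%:MP = 0.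
Proof.
rewrite /commp; case: (unlift _ _) => [l|]; first by rewrite mderivC scaler0.
apply/mpolyP => m; rewrite mcoeffZ mcoeff_map_mpoly mcoeffC mcoeff0.
by case: eqP => _ /=; rewrite ?mulr1 ?mulr0 ?ratderC ?raddf0 ?mulr0.
Qed.

Definition Ah_scale (c : F) (v : Ah) : Ah := Ah_rat c%:P%:F * v.

Lemma Ah_scalerA a b v : Ah_scale a (Ah_scale b v) = Ah_scale (a * b) v.
Proof. by rewrite /Ah_scale mulrA -!rmorphM. Qed.

Lemma Ah_scale1r : left_id 1 Ah_scale.
Proof. by move=> v; rewrite /Ah_scale !rmorph1 mul1r. Qed.

Lemma Ah_scalerDr : right_distributive Ah_scale +%R.
Proof. by move=> c v w; rewrite /Ah_scale mulrDr. Qed.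

Lemma Ah_scalerDl v : {morph Ah_scale^~ v : a b / a + b}.
Proof. by move=> a b; rewrite /Ah_scale !rmorphD mulrDl. Qed.

HB.instance Definition _ := GRing.Zmodule_isLmodule.Build F Ah
  Ah_scalerA Ah_scale1r Ah_scalerDr Ah_scalerDl.

Lemma Ah_scalerAl (c : F) (v w : Ah) : c *: (v * w) = (c *: v) * w.
Proof. exact: mulrA. Qed.

HB.instance Definition _ := GRing.Lmodule_isLalgebra.Build F Ah Ah_scalerAl.

Lemma Ah_scalerAr (c : F) (v w : Ah) : c *: (v * w) = v * (c *: w).
Proof.
rewrite -[LHS]/(Ah_rat _ * _) -[X in _ = _ * X]/(Ah_rat _ * _) /Ah_rat !Ah_coefME.
set r := _%:MP; rewrite -[RHS]/(opmul (opX commp) v (r *: _)).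
by rewrite (opmulZr commpC opXDc opX0c opXZc opX_monc) // => k; apply: commp_cst.
Qed.

HB.instance Definition _ := GRing.Lalgebra_isAlgebra.Build F Ah Ah_scalerAr.

Lemma Ah_algE (c : F) : c%:A = Ah_rat c%:P%:F :> Ah.
Proof. exact: mulr1. Qed.

Definition Ah_u : Ah := Ah_rat 'X%:F.
Definition Ah_pu : Ah := Ah_mom ord0.
Definition Ah_x (i : 'I_M) (j : 'I_N) : Ah := Ah_coef 'X_(mxvec_index i j).
Definition Ah_p (i : 'I_M) (j : 'I_N) : Ah := Ah_mom (lift ord0 (mxvec_index i j)).

Lemma Ah_rat_inj : injective Ah_rat.
Proof. exact: fmorph_inj. Qed.

Lemma Ah_pu_rat f : Ah_pu * Ah_rat f - Ah_rat f * Ah_pu = h *: Ah_rat (ratder f).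
Proof.
rewrite Ah_mom_coef /commp unlift_none -[RHS]/(Ah_rat _ * Ah_rat _) -rmorphM.
by rewrite map_mpolyC -mul_mpolyC -mpolyCM.
Qed.

Lemma Ah_pu_u : Ah_pu * Ah_u - Ah_u * Ah_pu = h%:A.
Proof. by rewrite Ah_pu_rat ratder_poly derivX tofrac1 rmorph1. Qed.

Lemma Ah_pu_x i j : Ah_pu * Ah_x i j = Ah_x i j * Ah_pu.
Proof.
apply/eqP; rewrite -subr_eq0 Ah_mom_coef /commp unlift_none.
by rewrite (map_derX (@ratderM F)) scaler0 raddf0.
Qed.

Lemma Ah_p_rat i j f : Ah_p i j * Ah_rat f = Ah_rat f * Ah_p i j.
Proof.
apply/eqP; rewrite -subr_eq0 Ah_mom_coef /commp liftK mderivC scaler0.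
by rewrite raddf0.
Qed.

Lemma Ah_p_x i j k l :
  Ah_p i j * Ah_x k l - Ah_x k l * Ah_p i j = h%:A *+ ((i == k) && (j == l)).
Proof.
rewrite Ah_mom_coef /commp liftK mderivX mnm1E.
have -> : (mxvec_index k l == mxvec_index i j) = (i == k) && (j == l).
  rewrite /mxvec_index (inj_eq (@cast_ord_inj _ _ _)) (inj_eq enum_rank_inj) xpair_eqE.
  by rewrite eq_sym [l == _]eq_sym.
case: andP => [[/eqP-> /eqP->]|_]; last by rewrite scale0r scaler0 raddf0.
have -> : (U_(mxvec_index k l) - U_(mxvec_index k l) = 0)%MM by apply/mnmP => s; rewrite mnmBE subnn mnmE.
rewrite mpolyX0 scale1r Ah_algE /Ah_rat; congr Ah_coef.
by rewrite alg_mpolyC.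
Qed.

Lemma Ah_x_rat i j f : Ah_x i j * Ah_rat f = Ah_rat f * Ah_x i j.
Proof. exact: Ah_coefC. Qed.

Lemma Ah_xC i j k l : Ah_x i j * Ah_x k l = Ah_x k l * Ah_x i j.
Proof. exact: Ah_coefC. Qed.

Lemma Ah_pC i j k l : Ah_p i j * Ah_p k l = Ah_p k l * Ah_p i j.
Proof. exact: Ah_momC. Qed.

Lemma Ah_pu_p i j : Ah_pu * Ah_p i j = Ah_p i j * Ah_pu.
Proof. exact: Ah_momC. Qed.

Lemma Ah_u_subE (c : F) : Ah_u - c%:A = Ah_rat ('X - c%:P)%:F.
Proof. by rewrite Ah_algE -rmorphB tofracB. Qed.

Lemma Ah_monE (m : 'X_{1..(M * N).+1}) :
  \prod_(k < (M * N).+1) Ah_mom k ^+ m k =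
  ('X_[m] : {mpoly Ahcoef[(M * N).+1]}) :> Ah.
Proof.
pose X m' : Ah := ('X_[m'] : {mpoly Ahcoef[(M * N).+1]}).
have XD : {morph X : m1 m2 / (m1 + m2)%MM >-> m1 * m2}.
  move=> m1 m2; rewrite -[RHS]/(opmul (opX commp) 'X_[m1] 'X_[m2]).
  rewrite -['X_[m1]]scale1r (opmul_mon (opX commp)) scale1r.
  by rewrite (opXm_mon commpC opXDc opX0c opXZc opX_monc).
have X0 : X 0%MM = 1 by exact: mpolyX0.
rewrite -[RHS]/(X m) [m in RHS]multinomUE_id (big_morph X XD X0).
apply: eq_bigr => k _; elim: (m k) => [|i IHi]; first by rewrite expr0 mulm0n X0.
by rewrite exprS IHi mulmS XD.
Qed.

Lemma Ah_normalE (v : Ah) :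
  v = \sum_(m <- msupp (v : {mpoly Ahcoef[(M * N).+1]}))
        Ah_coef (v : {mpoly Ahcoef[(M * N).+1]})@_m *
        \prod_(k < (M * N).+1) Ah_mom k ^+ m k.
Proof.
rewrite [LHS](mpolyE (v : {mpoly Ahcoef[(M * N).+1]})).
by apply: eq_bigr => m _; rewrite Ah_coefME Ah_monE.
Qed.

End Algebra.

(* \prod_(i < n) multiplies in increasing order of i, as rdet requires. *)
Definition rdet (R : pzRingType) (n : nat) (A : 'M[R]_n) : R :=
  \sum_(s : 'S_n) (-1) ^+ s * \prod_(i < n) A i (s i).

(* enum_val lists A and B in increasing order; the value is 0 if #|A| != #|B|. *)
Definition sub_det (R : pzRingType) (m n : nat) (X : 'M[R]_(m, n))
    (A : {set 'I_m}) (B : {set 'I_n}) : R :=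
  if #|A| =P #|B| is ReflectT eqAB then
    \det (\matrix_(i < #|A|, j < #|A|)
            X (enum_val i) (enum_val (cast_ord eqAB j)))
  else 0.

(* Elements of F(u) commute with every Ah_x and Ah_p, so the division may be
   written as right multiplication by 1 / (u - z_a). *)
Definition Gh (F : fieldType) (M N : nat) (h : F)
    (z : 'I_N -> F) (lambda : 'I_M -> F) : 'M[Ah M N h]_M :=
  \matrix_(i < M, j < M)
    ((Ah_pu M N h - (lambda i)%:A) *+ (i == j)
     - \sum_(a < N) Ah_x h j a * Ah_p h i a * Ah_rat M N h ('X - (z a)%:P)%:F^-1).

(* Main.v *)
From HB Require Import structures.
Require Import Defs.
From mathcomp Require Import all_boot all_order all_fingroup all_algebra.
From mathcomp Require Import reals complex.
From mathcomp Require Import ring mpoly.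

Set Implicit Arguments.
Unset Strict Implicit.
Unset Printing Implicit Defensive.

Import GRing.Theory.
Local Open Scope ring_scope.
Local Open Scope complex_scope.

(** Write every element of the algebra with coefficients (functions of u and the
x_ij) on the left and momenta on the right.  This identifies the algebra, as a
vector space, with a commutative polynomial ring C, and the claim becomes a
statement about left multiplications as operators on C.

Left multiplication by p_u is v |-> p_u v + h dv/du, and by p_ia it is
v |-> p_ia v + h dv/dx_ia.  Hence left multiplication by the entry G_ij is
g_ij + E_ij, where g_ij in C is the symbol of G_ij and E_ij is the derivation

  E_ij = h (delta_ij d/du - sum_a x_ja / (u - z_a) d/dx_ia).

Put T_kl = sum_a x_la p_ka / (u - z_a)^2.  Since d(1/(u - z_a))/du is
-1/(u - z_a)^2, a direct computation gives

  E_ij g_kl = h (delta_ij T_kl + delta_il T_kj),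

which is symmetric in j and l (G_der_exchange).  Now evaluate rdet G on 1, replacing
the operators g_ij + E_ij by plain multiplications one row at a time.  The
correction created by row i is, by the Leibniz rule, a sum over later rows k of
signed sums over permutations s with a factor E_(i,s i) g_(k,s k); composing s
with the transposition of i and k flips the sign and preserves the term, so each
of these sums vanishes.  Thus rdet G is the ordinary determinant of g, read as a
normally ordered element (rdet_normal_ordered, rdet_G_symbol).

What remains is commutative: g = diag(p_u - lambda_i) - P Y^T with P = (p_ia)
and Y = (x_ja / (u - z_a)).  Expanding in the diagonal gives the sum over A
(det_diagD), and the Cauchy-Binet formula for the principal minors of a product
gives the sum over B (det_mulmx_tr_sub).  Each resulting term is the symbol of
the product, taken in the algebra, on the right-hand side, because that product
is already normally ordered up to moving p_u past functions that do not
depend on u. *)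

(** * Derivations of a commutative ring *)

Section Derivation.
Variables (C : comPzRingType) (D : {additive C -> C}).
Hypothesis DM : forall v w, D (v * w) = D v * w + v * D w.

Lemma derivation1 : D 1 = 0.
Proof.
apply: (@addrI _ (D 1)).
by rewrite addr0 -[RHS](congr1 D (mulr1 1)) DM mulr1 mul1r.
Qed.

Lemma derivation_prod (I : eqType) (F : I -> C) s : uniq s ->
  D (\prod_(i <- s) F i)
  = \sum_(l <- s) D (F l) * \prod_(i <- s | i != l) F i.
Proof.
elim: s => [_|k s IHs /= /andP[ks us]]; first by rewrite !big_nil derivation1.
rewrite !big_cons DM IHs // eqxx /=; congr (_ * _ + _).
  rewrite big_seq_cond [RHS]big_seq_cond; apply: eq_bigl => i.
  by case: eqVneq => [->|]; rewrite ?(negbTE ks) ?andbT //.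
rewrite big_distrr /= !big_seq; apply: eq_bigr => l ls.
rewrite big_cons; case: eqVneq => [kl|_]; first by rewrite kl ls in ks.
by rewrite mulrCA.
Qed.

Lemma derivation_prod0 I (s : seq I) (F : I -> C) :
  (forall i, D (F i) = 0) -> D (\prod_(i <- s) F i) = 0.
Proof.
move=> F0; apply: (big_ind (fun v => D v = 0)) => // [|v w v0 w0].
  exact: derivation1.
by rewrite DM v0 w0 mul0r mulr0 addr0.
Qed.

Lemma derivation_sub_det0 m n (X : 'M[C]_(m, n)) A B :
  (forall i j, D (X i j) = 0) -> D (sub_det X A B) = 0.
Proof.
move=> X0; rewrite /sub_det; case: eqP => [e|_]; last exact: raddf0.
rewrite raddf_sum big1 // => s _; rewrite -signr_odd.
case: (odd _); rewrite ?mulN1r ?mul1r ?raddfN derivation_prod0 ?oppr0 // => i;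
  by rewrite mxE.
Qed.

End Derivation.

(** * Row determinants and normal ordering *)

Lemma alternating_sum0 (A : pzRingType) n (F : 'S_n -> A) i j : i != j ->
  (forall s, F (tperm i j * s)%g = F s) -> \sum_(s : 'S_n) (-1) ^+ s * F s = 0.
Proof.
move=> ij FE; rewrite (bigID (@odd_perm _)) /=.
rewrite (reindex_inj (mulgI (tperm i j))) /=.
have E2 s : odd_perm (tperm i j * s)%g = ~~ odd_perm s by rewrite odd_mul_tperm ij.
apply/eqP; rewrite addr_eq0 -sumrN; apply/eqP; apply: eq_big => [s|s].
  by rewrite E2.
by rewrite E2 FE => /negbTE->; rewrite mulN1r mul1r.
Qed.

Section NormalOrderedRdet.
Variables (A : pzRingType) (C : comPzRingType) (S : {additive C -> A}) (n : nat).
Variables (G : 'M[A]_n) (g : 'M[C]_n) (E : 'I_n -> 'I_n -> {additive C -> C}).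

Hypothesis EM : forall i j v w, E i j (v * w) = E i j v * w + v * E i j w.
Hypothesis Eexch : forall i k j l, E i j (g k l) = E i l (g k j).
Hypothesis GE : forall i j v, G i j * S v = S (g i j * v + E i j v).
Hypothesis S1 : S 1 = 1.

(** S reads an element of C as a normally ordered element of A, so that GE says
that left multiplication by G i j acts on C as g i j + E i j.  Eexch makes the
corrections by E cancel in pairs of permutations, leaving a determinant over the
commutative ring C. *)
Lemma rdet_normal_ordered : rdet G = S (\det g).
Proof.
(* T s1 s2: the rows in s1 still act as operators, those in s2 are symbols. *)
pose T s1 s2 := \sum_(s : 'S_n) (-1) ^+ s
  * (\prod_(i <- s1) G i (s i) * S (\prod_(i <- s2) g i (s i))).
have T0 : T [::] (index_enum 'I_n) = S (\det g).
  rewrite raddf_sum; apply: eq_bigr => s _.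
  by rewrite big_nil mul1r; case: (odd_perm s); rewrite ?mulN1r ?mul1r ?raddfN.
have T1 : T (index_enum 'I_n) [::] = rdet G.
  by apply: eq_bigr => s _; rewrite big_nil S1 mulr1.
suff TE s1 s2 : uniq (s1 ++ s2) -> T s1 s2 = T [::] (s1 ++ s2).
  by rewrite -T1 -T0 TE ?cats0 // index_enum_uniq.
elim/last_ind: s1 s2 => // s1 k IHs s2; rewrite cat_rcons => us.
rewrite -IHs //; apply/eqP; rewrite -subr_eq0 -sumrB.
have [uk us2]: k \notin s1 ++ s2 /\ uniq s2.
  move: us; rewrite -cat_rcons cat_uniq rcons_uniq mem_cat.
  case/and3P=> /andP[/negbTE-> _] /hasPn h ->; split=> //=.
  by apply/negP=> /h; rewrite mem_rcons inE eqxx.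
rewrite mem_cat negb_or in uk; case/andP: uk => ks1 ks2.
(* The two sums differ by the action of E k (s k) on a later row l. *)
pose w l (s : 'S_n) := \prod_(i <- s1) G i (s i)
   * S (E k (s k) (g l (s l)) * \prod_(i <- s2 | i != l) g i (s i)).
rewrite (eq_bigr (fun s : 'S_n => \sum_(l <- s2) (-1) ^+ s * w l s));
  last first=> [s _|].
  rewrite -big_distrr /= -mulrBr; congr (_ * _).
  rewrite -cats1 big_cat big_seq1 /= big_cons -mulrA GE -mulrBr -raddfB addrC addKr.
  by rewrite (derivation_prod (EM k (s k))) // raddf_sum /= big_distrr.
rewrite exchange_big big_seq big1 //= => l ls2.
have kl : k != l by apply: contraNneq ks2 => ->.
have l1 : l \notin s1.
  apply: contraL us => l1; rewrite cat_uniq; apply/negP=> /and3P[_ /hasPn/(_ l)].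
  by rewrite inE ls2 orbT /= l1 => /(_ isT).
apply: (alternating_sum0 kl) => s; rewrite /w !permM tpermL tpermR Eexch.
congr (_ * S (_ * _)).
  rewrite !big_seq; apply: eq_bigr => i i1; rewrite permM tpermD //.
    by apply: contraNneq ks1 => ->.
  by apply: contraNneq l1 => ->.
rewrite big_seq_cond [RHS]big_seq_cond; apply: eq_bigr => i /andP[i2 il].
by rewrite permM tpermD // 1?[_ == i]eq_sym //; apply: contraNneq ks2 => <-.
Qed.

End NormalOrderedRdet.

(** * Minors over a commutative ring *)

Section Minors.
Variable R : comPzRingType.

Lemma det_mxsub_bij n m (f : 'I_n -> 'I_m) (A : 'M[R]_m) :
  bijective f -> \det (mxsub f f A) = \det A.
Proof.
move=> bf; have := bij_eq_card bf; rewrite !card_ord => nm.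
rewrite -{m}nm in f A bf *; have fi := bij_inj bf.
have -> : mxsub f f A = row_perm (perm fi) (col_perm (perm fi) A).
  by apply/matrixP => i j; rewrite !mxE !permE.
rewrite row_permE col_permE !det_mulmx !det_perm odd_permV mulrC -mulrA.
by rewrite -signr_addb addbb mulr1.
Qed.

(** Row-multilinearity: choosing W in the rows of A and the diagonal elsewhere
leaves, after listing A before its complement, a block triangular matrix. *)
Lemma det_diagD m (d : 'rV[R]_m) (W : 'M[R]_m) :
  \det (diag_mx d + W) = \sum_(A : {set 'I_m})
     \prod_(b < m | b \notin A) d 0 b
     * \det (mxsub (@enum_val _ (mem A)) (@enum_val _ (mem A)) W).
Proof.
pose X (A : {set 'I_m}) := \matrix_(i, j) if i \in A then W i j else diag_mx d i j.
transitivity (\sum_(A : {set 'I_m}) \det (X A)).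
  rewrite exchange_big; apply: eq_bigr => s _ /=.
  under eq_bigr do rewrite mxE addrC.
  rewrite bigA_distr big_distrr /=; apply: eq_bigr => A _.
  by congr (_ * _); apply: eq_bigr => i _; rewrite [RHS]mxE.
apply: eq_bigr => A _.
(* f lists A first, then its complement. *)
pose f (k : 'I_(#|A| + #|~: A|)) : 'I_m :=
  match split k with inl a => enum_val a | inr b => enum_val b end.
have fi : injective f.
  move=> k l; rewrite /f; rewrite -{2}[k]splitK -{2}[l]splitK.
  case: (split k) (split l) => [a|b] [a'|b'] /=.
  - by move/enum_val_inj->.
  - by move=> e; have := enum_valP b'; rewrite -e inE (enum_valP a).
  - by move=> e; have := enum_valP b; rewrite e inE (enum_valP a').
  - by move/enum_val_inj->.
have bf : bijective f by apply: inj_card_bij => //; rewrite !card_ord cardsC card_ord.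
have fl a : f (lshift _ a) = enum_val a.
  by rewrite /f (unsplitK (inl _ a)).
have fr b : f (rshift _ b) = enum_val b.
  by rewrite /f (unsplitK (inr _ b)).
rewrite -(det_mxsub_bij _ bf).
set e := @enum_val _ (mem A).
have -> : mxsub f f (X A) = block_mx (mxsub e e W)
   (mxsub e (@enum_val _ (mem (~: A))) W) 0
   (diag_mx (\row_b d 0 (@enum_val _ (mem (~: A)) b))).
  apply/matrixP => i j; rewrite -(splitK i) -(splitK j) [LHS]mxE.
  case: (split i) (split j) => [a|b] [a'|b'] /=;
    rewrite ?(fl, fr, block_mxEul, block_mxEur, block_mxEdl, block_mxEdr) !mxE.
  - by rewrite enum_valP.
  - by rewrite enum_valP.
  - have := enum_valP b; rewrite inE => /[dup] bA /negbTE->.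
    case: eqP => // e'; have := bA; rewrite e' enum_valP //.
  - have := enum_valP b; rewrite inE => /negbTE->.
    by rewrite (inj_eq enum_val_inj).
rewrite det_ublock mulrC det_diag; congr (_ * _).
under eq_bigr do rewrite mxE.
rewrite -(big_enum_val (fun i => d 0 i)) /=.
by apply: eq_bigl => i; rewrite inE.
Qed.

(** The Cauchy-Binet formula.  Multilinearity in the rows gives a sum over all
maps f from rows to columns; a non-injective f contributes a determinant with two
equal columns, and the injective f with image B are the enumeration of B composed
with a permutation. *)
Lemma det_mulmx_tr_sub m n (P Y : 'M[R]_(m, n)) (A : {set 'I_m}) :
  \det (mxsub (@enum_val _ (mem A)) (@enum_val _ (mem A)) (P *m Y^T))
  = \sum_(B : {set 'I_n} | #|A| == #|B|) sub_det P A B * sub_det Y A B.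
Proof.
set a := @enum_val _ (mem A).
pose DY (f : 'I_#|A| -> 'I_n) := \det (\matrix_(i, j) Y (a i) (f j)).
pose t (f : {ffun 'I_#|A| -> 'I_n}) := \prod_i P (a i) (f i) * DY f.
transitivity (\sum_f t f).
  under [RHS]eq_bigr => f _ do rewrite /t /DY -det_tr big_distrr.
  rewrite exchange_big; apply: eq_bigr => s _ /=.
  under eq_bigr do rewrite !mxE.
  rewrite bigA_distr_bigA big_distrr /=; apply: eq_bigr => f _.
  rewrite mulrCA -big_split; congr (_ * _); apply: eq_bigr => i _ /=.
  by rewrite !mxE.
rewrite (bigID (fun f : {ffun _ -> _} => injectiveb f)) /= addrC.
rewrite big1 => [|f]; last first.
  move/injectivePn=> [i [j ij fij]]; rewrite /t /DY -det_tr.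
  by rewrite (determinant_alternate ij) ?mulr0 // => k; rewrite !mxE fij.
rewrite add0r (partition_big (fun f : {ffun _ -> _} => f @: setT)
  (fun B : {set 'I_n} => #|A| == #|B|)) /= => [|f /injectiveP fi]; last first.
  by rewrite card_imset // cardsT card_ord.
apply: eq_bigr => B; rewrite /sub_det; case: eqP => // eqAB _.
pose b (j : 'I_#|A|) := @enum_val _ (mem B) (cast_ord eqAB j).
have bi : injective b by move=> i j /enum_val_inj/cast_ord_inj.
have bB j : b j \in B by apply: enum_valP.
(* The maps with image B, indexed by permutations. *)
pose fs (s : {perm 'I_#|A|}) := [ffun i => b (s i)].
have fsi : injective fs.
  by move=> s s' /ffunP e; apply/permP => i; have := e i; rewrite !ffunE => /bi.
have im_fs s : fs s @: setT = B.
  apply/eqP; rewrite eqEcard card_imset; last first.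
    by move=> i j; rewrite !ffunE => /bi/perm_inj.
  rewrite cardsT card_ord -eqAB leqnn andbT.
  by apply/subsetP => _ /imsetP[i _ ->]; rewrite ffunE.
transitivity (\sum_(f in fs @: setT) t f).
  apply: eq_bigl => f; apply/andP/imsetP => [[/injectiveP fi /eqP fB]|[s _ ->]].
    have fx i : exists j, b j == f i.
      have fiB : f i \in B by rewrite -fB imset_f.
      exists (cast_ord (esym eqAB) (enum_rank_in fiB (f i))).
      by rewrite /b cast_ordKV enum_rankK_in.
    pose s i := xchoose (fx i).
    have sE i : b (s i) = f i by apply/eqP/(xchooseP (fx i)).
    have si : injective s by move=> i j e; apply: fi; rewrite -!sE e.
    by exists (perm si) => //; apply/ffunP => i; rewrite ffunE permE sE.
  split; last by rewrite im_fs.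
  by apply/injectiveP => i j; rewrite !ffunE => /bi/perm_inj.
rewrite big_imset /=; last by move=> s s' _ _ /fsi.
rewrite [X in X * _]/determinant mulr_suml big_mkcond.
apply: eq_bigr => s _; rewrite inE.
rewrite /t -mulrA mulrCA; congr (_ * _).
  by apply: eq_bigr => i _; rewrite !mxE ffunE.
have -> : DY (fs s) = \det (col_perm s (\matrix_(i, j) Y (a i) (b j))).
  by congr (\det _); apply/matrixP => i j; rewrite !mxE ffunE.
by rewrite col_permE det_mulmx det_perm odd_permV mulrC.
Qed.

End Minors.

(** * The symbol of the matrix G *)

(* Capital letters are elements of A, and the lower case ones their symbols in C:
pu, p, x, f, l stand for p_u, p_ia, x_ia, 1 / (u - z_a), lambda_i, the derivations
d0 and d i a for h d/du and h d/dx_ia, and k for h. *)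
Section GSymbol.
Variables (A : pzRingType) (C : comPzRingType) (S : {additive C -> A}) (M N : nat).
Variables (Pu : A) (P X : 'I_M -> 'I_N -> A) (Phi : 'I_N -> A) (L : 'I_M -> A).
Variables (pu : C) (p x : 'I_M -> 'I_N -> C) (f : 'I_N -> C) (l : 'I_M -> C).
Variables (d0 : {additive C -> C}) (d : 'I_M -> 'I_N -> {additive C -> C}) (k : C).

Hypothesis S1 : S 1 = 1.
Hypothesis PuE : forall v, Pu * S v = S (pu * v + d0 v).
Hypothesis PE : forall i a v, P i a * S v = S (p i a * v + d i a v).
Hypothesis XE : forall i a v, X i a * S v = S (x i a * v).
Hypothesis PhiE : forall a v, Phi a * S v = S (f a * v).
Hypothesis LE : forall i v, L i * S v = S (l i * v).

Hypothesis d0M : forall v w, d0 (v * w) = d0 v * w + v * d0 w.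
Hypothesis dM : forall i a v w, d i a (v * w) = d i a v * w + v * d i a w.
Hypothesis d0pu : d0 pu = 0.
Hypothesis d0p : forall i a, d0 (p i a) = 0.
Hypothesis d0x : forall i a, d0 (x i a) = 0.
Hypothesis d0f : forall a, d0 (f a) = - (k * f a ^+ 2).
Hypothesis d0l : forall i, d0 (l i) = 0.
Hypothesis dpu : forall i a, d i a pu = 0.
Hypothesis dp : forall i a j b, d i a (p j b) = 0.
Hypothesis dx : forall i a j b, d i a (x j b) = k *+ ((i == j) && (a == b)).
Hypothesis df : forall i a b, d i a (f b) = 0.
Hypothesis dl : forall i a j, d i a (l j) = 0.

Definition G_symbol : 'M[C]_M := \matrix_(i, j)
  ((pu - l i) *+ (i == j) - \sum_(a < N) x j a * p i a * f a).

(** The difference between left multiplication by an entry of G, acting on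
symbols, and multiplication by its symbol. *)
Definition G_der (i j : 'I_M) (v : C) : C :=
  d0 v *+ (i == j) - \sum_(a < N) x j a * f a * d i a v.

Fact G_der_zmod i j : zmod_morphism (G_der i j).
Proof.
move=> v w; rewrite /G_der.
have -> : \sum_(a < N) x j a * f a * d i a (v - w)
  = \sum_(a < N) x j a * f a * d i a v - \sum_(a < N) x j a * f a * d i a w.
  by rewrite -sumrB; apply: eq_bigr => a _; rewrite raddfB mulrBr.
by rewrite raddfB mulrnBl !opprB addrACA [RHS]addrACA [- _ + - _]addrC.
Qed.

HB.instance Definition _ i j :=
  GRing.isZmodMorphism.Build C C (G_der i j) (G_der_zmod i j).

Lemma G_derM i j v w : G_der i j (v * w) = G_der i j v * w + v * G_der i j w.
Proof.
rewrite /G_der d0M mulrnDl mulrBl mulrBr mulrnAl mulrnAr addrACA -opprD.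
congr (_ - _); rewrite mulr_suml mulr_sumr -big_split /=.
by apply: eq_bigr => a _; rewrite dM; ring.
Qed.

(** The diagonal part differentiates f and the off-diagonal part differentiates x;
the minus sign in the derivative of f = 1 / (u - z_a) is what makes the two
contributions, delta_(i j) t n and delta_(i n) t j, exchange places. *)
Lemma G_der_exchange i m j n : G_der i j (G_symbol m n) = G_der i n (G_symbol m j).
Proof.
pose t n := \sum_(a < N) k * f a ^+ 2 * x n a * p m a.
suff E j' n' : G_der i j' (G_symbol m n') = t n' *+ (i == j') + t j' *+ (i == n').
  by rewrite !E addrC.
rewrite /G_der mxE; congr (_ *+ _ + _).
  rewrite raddfB raddfMn raddfB d0pu d0l subr0 mul0rn sub0r raddf_sum -sumrN.
  by apply: eq_bigr => a _; rewrite !d0M d0x d0p d0f; ring.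
rewrite -sumrN -sumrMnl; apply: eq_bigr => a _.
rewrite raddfB raddfMn raddfB dpu dl subr0 mul0rn sub0r raddf_sum (bigD1 a) //=.
rewrite big1 => [|b ba]; rewrite !dM dx dp df ?eqxx ?andbT.
  by case: (i == n') => /=; ring.
by rewrite [a == b]eq_sym (negbTE ba) andbF mulr0n; ring.
Qed.

Lemma rdet_G_symbol :
  rdet (\matrix_(i < M, j < M)
    ((Pu - L i) *+ (i == j) - \sum_(a < N) X j a * P i a * Phi a))
  = S (\det G_symbol).
Proof.
apply: (rdet_normal_ordered G_derM G_der_exchange _ S1) => i j v.
rewrite /G_der !mxE mulrBl mulrnAl mulrBl PuE LE mulr_suml.
rewrite -raddfB -raddfMn.
rewrite (eq_bigr (fun a => S (x j a * (p i a * (f a * v) + f a * d i a v)))) => [|a _].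
  rewrite -raddf_sum -raddfB; congr (S _).
  rewrite [X in _ = X]addrC.
  rewrite [in RHS]mulrBl mulr_suml mulrnAl addrACA -mulrnDl -opprD -big_split /=.
  congr (_ *+ _ - _); first by ring.
  by apply: eq_bigr => a _; ring.
by rewrite -!mulrA PhiE PE XE dM df mul0r add0r.
Qed.

End GSymbol.

Section CommutativeExpansion.
Variables (C : comPzRingType) (M N : nat).
Variables (pu : C) (p x : 'I_M -> 'I_N -> C) (f : 'I_N -> C) (l : 'I_M -> C).

Lemma sub_det_scale (Y : 'M[C]_(M, N)) (c : 'I_N -> C) A B :
  sub_det (\matrix_(i, a) (Y i a * c a)) A B
  = (\prod_(a in B) c a) * sub_det Y A B.
Proof.
rewrite /sub_det; case: eqP => [e|_]; last by rewrite mulr0.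
set W := (X in _ * \det X).
pose D := \row_(j < #|A|) c (enum_val (cast_ord e j)).
have -> : (\matrix_(i < #|A|, j < #|A|) (\matrix_(i, a) (Y i a * c a))
  (enum_val i) (enum_val (cast_ord e j))) = W *m diag_mx D.
  by apply/matrixP => i j; rewrite mul_mx_diag !mxE.
rewrite det_mulmx det_diag mulrC; congr (_ * _).
rewrite [RHS]big_enum_val [RHS](reindex (cast_ord e)) /=; last first.
  exact/onW_bij/(Bijective (cast_ordK e) (cast_ordKV e)).
by apply: eq_bigr => j _; rewrite mxE.
Qed.

(** G_symbol = diag(pu - l) - p (x f)^T, so det_diagD followed by Cauchy-Binet
yields the double sum; the factors f a for a in B cancel those of \prod u a. *)
Lemma det_G_symbol (u : 'I_N -> C) : (forall a, u a * f a = 1) ->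
  \prod_a u a * \det (G_symbol pu p x f l)
  = \sum_(A : {set 'I_M}) \sum_(B : {set 'I_N} | #|A| == #|B|)
    (-1) ^+ #|A| * \prod_(a | a \notin B) u a * \prod_(b | b \notin A) (pu - l b)
    * sub_det (\matrix_(i, j) x i j) A B * sub_det (\matrix_(i, j) p i j) A B.
Proof.
move=> uf.
have -> : G_symbol pu p x f l = diag_mx (\row_i (pu - l i)) +
   (\matrix_(i, j) p i j) *m (\matrix_(i, a) ((\matrix_(i, j) x i j) i a * - f a))^T.
  apply/matrixP => i j; rewrite !mxE -sumrN; congr (_ + _).
  by apply: eq_bigr => a _; rewrite !mxE; ring.
rewrite det_diagD big_distrr; apply: eq_bigr => A _ /=.
rewrite det_mulmx_tr_sub !big_distrr; apply: eq_bigr => B /eqP AB /=.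
rewrite sub_det_scale prodrN -AB.
have -> : \prod_(b | b \notin A) (\row_i (pu - l i)) 0 b
          = \prod_(b | b \notin A) (pu - l b).
  by apply: eq_bigr => b _; rewrite mxE.
have -> : \prod_a u a = \prod_(a in B) u a * \prod_(a | a \notin B) u a.
  exact: bigID.
have e : \prod_(a in B) u a * \prod_(a in B) f a = 1.
  by rewrite -big_split big1 // => a _; apply: uf.
set U := \prod_(a in B) u a in e *; set Phi := \prod_(a in B) f a in e *.
transitivity (U * Phi * ((-1) ^+ #|A| * \prod_(a | a \notin B) u a
    * \prod_(b | b \notin A) (pu - l b)
    * sub_det (\matrix_(i, j) x i j) A B * sub_det (\matrix_(i, j) p i j) A B)).
  by ring.
by rewrite e mul1r.
Qed.

End CommutativeExpansion.

(** * Normally ordered products in the algebra *)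

Section Symbols.
Variables (F : fieldType) (M N : nat) (h : F).
Local Notation K := {fraction {poly F}}.
Local Notation B := {mpoly K[M * N]}.
Local Notation C := {mpoly B[(M * N).+1]}.
Local Notation Ah := (Ah M N h).

(** The algebra and C have the same underlying polynomials and differ only in
their products; this identity map marks the passage from the commutative product
to the noncommutative one. *)
Definition Ah_of_symbol (v : C) : Ah := v.

Fact Ah_of_symbol_zmod : zmod_morphism Ah_of_symbol.
Proof. by []. Qed.

HB.instance Definition _ :=
  GRing.isZmodMorphism.Build C Ah Ah_of_symbol Ah_of_symbol_zmod.

Fact commp_zmod k : zmod_morphism (@commp F M N h k).
Proof. exact: (der_zmod (@commpD F M N h)). Qed.

HB.instance Definition _ k :=
  GRing.isZmodMorphism.Build B B (@commp F M N h k) (commp_zmod k).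

(** h d/du for k = 0 and h d/dx_ij for the other k, acting on symbols with all
momenta treated as constants. *)
Definition mom_der (k : 'I_(M * N).+1) (v : C) : C := map_mpoly (commp h k) v.

HB.instance Definition _ k :=
  GRing.Additive.copy (mom_der k) (map_mpoly (commp h k)).

Lemma mom_derM k v w : mom_der k (v * w) = mom_der k v * w + v * mom_der k w.
Proof. exact: (map_derM (@commpM F M N h k)). Qed.

Lemma mom_derB k v w : mom_der k (v - w) = mom_der k v - mom_der k w.
Proof. exact: (raddfB (mom_der k)). Qed.

Lemma mom_derX k l : mom_der k 'X_l = 0.
Proof. exact: (map_derX (@commpM F M N h k)). Qed.

Lemma mom_derC k r : mom_der k r%:MP = (commp h k r)%:MP.
Proof. exact: map_mpolyC. Qed.

Lemma Ah_mom_symbol k v :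
  Ah_mom h k * Ah_of_symbol v = Ah_of_symbol ('X_k * v + mom_der k v).
Proof. exact: Ah_momME. Qed.

Lemma Ah_coef_symbol r v : Ah_coef h r * Ah_of_symbol v = Ah_of_symbol (r%:MP * v).
Proof. by rewrite Ah_coefME mul_mpolyC. Qed.

Local Notation momp i a := (lift ord0 (mxvec_index i a) : 'I_(M * N).+1).

Lemma commp_pu_x j a : commp h ord0 ('X_(mxvec_index j a) : B) = 0.
Proof. by rewrite /commp unlift_none (map_derX (@ratderM F)) scaler0. Qed.

Lemma commp_pu_rat (f : K) : commp h ord0 (f%:MP : B) = (h%:P%:F * ratder f)%:MP.
Proof. by rewrite /commp unlift_none map_mpolyC -mul_mpolyC -mpolyCM. Qed.

Lemma commp_p_rat i a (f : K) : commp h (momp i a) (f%:MP : B) = 0.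
Proof. by rewrite /commp liftK mderivC scaler0. Qed.

Lemma commp_p_x i a j b : commp h (momp i a) ('X_(mxvec_index j b) : B)
  = (h%:P%:F *+ ((i == j) && (a == b)))%:MP.
Proof.
apply: (@Ah_coef_inj F M N h); have := Ah_p_x h i a j b.
rewrite Ah_mom_coef Ah_algE => ->.
exact/esym/(raddfMn (@Ah_rat F M N h)).
Qed.

Lemma ratder_inv_linear (c : F) :
  ratder (('X - c%:P)%:F^-1 : K) = - ('X - c%:P)%:F^-1 ^+ 2.
Proof.
rewrite -[X in ratder X]mul1r -tofrac1 ratder_frac ?polyXsubC_eq0 //.
rewrite derivXsubC -[1]/(1%:P) derivC mul0r sub0r mulr1.
by rewrite tofracN tofrac1 tofracXn mulN1r exprVn.
Qed.

Lemma mom_der_prodX k I (s : seq I) (m : I -> 'I_(M * N).+1) :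
  mom_der k (\prod_(i <- s) 'X_(m i)) = 0.
Proof.
pose D : {additive C -> C} := mom_der k.
by apply: (@derivation_prod0 C D (@mom_derM k)) => i; apply: mom_derX.
Qed.

Lemma mom_der_sub_det k m n (X : 'M[C]_(m, n)) (a : {set 'I_m}) (b : {set 'I_n}) :
  (forall i j, mom_der k (X i j) = 0) -> mom_der k (sub_det X a b) = 0.
Proof.
pose D : {additive C -> C} := mom_der k.
exact: (@derivation_sub_det0 C D (@mom_derM k)).
Qed.

Lemma prod_Ah_mom I (s : seq I) (m : I -> 'I_(M * N).+1) :
  \prod_(i <- s) Ah_mom h (m i) = Ah_of_symbol (\prod_(i <- s) 'X_(m i)).
Proof.
elim: s => [|i s IHs]; first by rewrite !big_nil.
by rewrite !big_cons IHs Ah_mom_symbol mom_der_prodX addr0.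
Qed.

Lemma Ah_sign_symbol n v : (-1) ^+ n * Ah_of_symbol v = Ah_of_symbol ((-1) ^+ n * v).
Proof.
rewrite -signr_odd -[in RHS]signr_odd.
by case: (odd n); rewrite ?mulN1r ?mul1r //; exact/esym/(raddfN Ah_of_symbol).
Qed.

Lemma det_Ah_mom n (m : 'I_n -> 'I_n -> 'I_(M * N).+1) :
  \det (\matrix_(i, j) Ah_mom h (m i j))
  = Ah_of_symbol (\det (\matrix_(i, j) 'X_(m i j))).
Proof.
rewrite [in RHS]/determinant (raddf_sum Ah_of_symbol); apply: eq_bigr => s _.
apply: etrans (Ah_sign_symbol _ _); congr (_ * _).
under eq_bigr do rewrite mxE; under [in RHS]eq_bigr do rewrite mxE.
exact: prod_Ah_mom.
Qed.

End Symbols.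

Lemma sub_det_map (R R' : pzRingType) (f : {rmorphism R -> R'}) m n
    (X : 'M[R]_(m, n)) A B :
  sub_det (map_mx f X) A B = f (sub_det X A B).
Proof.
rewrite /sub_det; case: eqP => [e|_]; last by rewrite rmorph0.
by rewrite -det_map_mx; congr (\det _); apply/matrixP => i j; rewrite !mxE.
Qed.

Lemma mulr5A (R : pzRingType) (a b c d e : R) :
  a * b * c * d * e = a * (b * (c * (d * e))).
Proof. by rewrite !mulrA. Qed.

(** * The Capelli identity over any field *)

Section Capelli.
Variables (F : fieldType) (M N : nat) (h : F) (z : 'I_N -> F) (lam : 'I_M -> F).
Local Notation K := {fraction {poly F}}.
Local Notation B := {mpoly K[M * N]}.
Local Notation C := {mpoly B[(M * N).+1]}.
Local Notation Ah := (Ah M N h).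
Local Notation sym := (@Ah_of_symbol F M N h).

Definition symbol_pu : C := 'X_ord0.
Definition symbol_p i a : C := 'X_(lift ord0 (mxvec_index i a)).
Definition symbol_x i a : C := ('X_(mxvec_index i a) : B)%:MP.
Definition symbol_rat (r : K) : C := (r%:MP : B)%:MP.
Let symbol_l i : C := symbol_rat (lam i)%:P%:F.
Let symbol_f a : C := symbol_rat ('X - (z a)%:P)%:F^-1.
Let symbol_u a : C := symbol_rat ('X - (z a)%:P)%:F.

Lemma rdet_Gh :
  rdet (Gh h z lam)
  = sym (\det (G_symbol symbol_pu symbol_p symbol_x symbol_f symbol_l)).
Proof.
pose S : {additive C -> Ah} := Ah_of_symbol h.
pose d0 : {additive C -> C} := mom_der h ord0.
pose d i a : {additive C -> C} := mom_der h (lift ord0 (mxvec_index i a)).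
apply: (@rdet_G_symbol Ah C S M N (Ah_pu M N h) (Ah_p h) (Ah_x h)
  (fun a => Ah_rat M N h ('X - (z a)%:P)%:F^-1) (fun i => (lam i)%:A)
  symbol_pu symbol_p symbol_x symbol_f symbol_l d0 d (symbol_rat h%:P%:F)).
- by [].
- exact: Ah_mom_symbol.
- move=> i a; exact: Ah_mom_symbol.
- move=> i a v; exact: Ah_coef_symbol.
- move=> a v; exact: Ah_coef_symbol.
- move=> i v; rewrite Ah_algE; exact: Ah_coef_symbol.
- exact: mom_derM.
- move=> i a; exact: mom_derM.
- exact: mom_derX.
- move=> i a; exact: mom_derX.
- by move=> i a; rewrite /= mom_derC commp_pu_x mpolyC0.
- move=> a; rewrite /= mom_derC commp_pu_rat ratder_inv_linear.
  by rewrite /symbol_f /symbol_rat mulrN !mpolyCN !mpolyCM expr2.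
- by move=> i; rewrite /= mom_derC commp_cst mpolyC0.
- by move=> i a; apply: mom_derX.
- by move=> i a j b; apply: mom_derX.
- move=> i a j b; rewrite /= mom_derC commp_p_x.
  by rewrite /symbol_rat; case: (_ && _).
- by move=> i a b; rewrite /= mom_derC commp_p_rat mpolyC0.
- by move=> i a j; rewrite /= mom_derC commp_cst mpolyC0.
Qed.

Lemma prod_rat_symbol (P : pred 'I_N) v :
  (\prod_(a < N | P a) (Ah_u M N h - (z a)%:A)) * sym v
  = sym ((\prod_(a < N | P a) symbol_u a) * v).
Proof.
elim/big_rec2: _ v => [v|a y1 y2 _ IH v]; first by rewrite !mul1r.
by rewrite -mulrA IH Ah_u_subE Ah_coef_symbol mulrA.
Qed.

(** p_u passes unchanged through symbols that do not depend on u, and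
multiplying such a symbol by p_u - lambda_b keeps it independent of u. *)
Lemma prod_pu_symbol (P : pred 'I_M) v : mom_der h ord0 v = 0 ->
  (\prod_(b < M | P b) (Ah_pu M N h - (lam b)%:A)) * sym v
  = sym ((\prod_(b < M | P b) (symbol_pu - symbol_l b)) * v).
Proof.
move=> v0.
suff [_ ->] : mom_der h ord0 ((\prod_(b < M | P b) (symbol_pu - symbol_l b)) * v) = 0
  /\ (\prod_(b < M | P b) (Ah_pu M N h - (lam b)%:A)) * sym v
  = sym ((\prod_(b < M | P b) (symbol_pu - symbol_l b)) * v) by [].
elim/big_rec2: _ => [|b y1 y2 _ [y0 IH]]; first by rewrite !mul1r.
split.
  rewrite -mulrA mom_derM y0 mulr0 addr0 mom_derB mom_derX mom_derC commp_cst.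
  by rewrite mpolyC0 subr0 mul0r.
rewrite -mulrA IH -mulrA mulrBl Ah_algE [X in _ - X]Ah_coef_symbol.
rewrite Ah_mom_symbol y0 addr0 mulrBl.
exact/esym/(raddfB sym).
Qed.

Lemma sub_det_x_symbol A B :
  sub_det (\matrix_(i < M, j < N) Ah_x h i j) A B
  = Ah_coef h (sub_det (\matrix_(i < M, j < N) 'X_(mxvec_index i j)) A B).
Proof.
rewrite -(sub_det_map (@Ah_coef F M N h)); congr (sub_det _ A B).
by apply/matrixP => i j; rewrite !mxE.
Qed.

Lemma sub_det_symbol_x A B :
  sub_det (\matrix_(i < M, j < N) symbol_x i j) A B
  = (sub_det (\matrix_(i < M, j < N) ('X_(mxvec_index i j) : {mpoly K[M * N]}))
       A B)%:MP.
Proof.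
rewrite -(sub_det_map (@mpolyC (M * N).+1 {mpoly K[M * N]})).
congr (sub_det _ A B).
by apply/matrixP => i j; rewrite !mxE.
Qed.

Lemma sub_det_p_symbol A B :
  sub_det (\matrix_(i < M, j < N) Ah_p h i j) A B
  = sym (sub_det (\matrix_(i < M, j < N) symbol_p i j) A B).
Proof.
rewrite /sub_det; case: eqP => // e.
pose m (i j : 'I_#|A|) := lift ord0
  (mxvec_index (@enum_val _ (mem A) i) (@enum_val _ (mem B) (cast_ord e j))).
transitivity (\det (\matrix_(i, j) Ah_mom h (m i j))).
  by congr (\det _); apply/matrixP => i j; rewrite !mxE.
by rewrite det_Ah_mom; congr (sym (\det _)); apply/matrixP => i j; rewrite !mxE.
Qed.

Lemma normally_ordered_term n (Q : pred 'I_N) (P : pred 'I_M) (U V : Ah) r (w v : C) :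
  U = Ah_coef h r -> w = r%:MP -> V = sym v ->
  mom_der h ord0 v = 0 -> mom_der h ord0 w = 0 ->
  (-1) ^+ n * \prod_(a < N | Q a) (Ah_u M N h - (z a)%:A)
    * \prod_(b < M | P b) (Ah_pu M N h - (lam b)%:A) * U * V
  = sym ((-1) ^+ n * \prod_(a < N | Q a) symbol_u a
    * \prod_(b < M | P b) (symbol_pu - symbol_l b) * w * v).
Proof.
move=> -> -> -> v0 r0; rewrite mulr5A Ah_coef_symbol prod_pu_symbol; last first.
  by rewrite mom_derM v0 r0 mul0r mulr0 addr0.
by rewrite prod_rat_symbol Ah_sign_symbol [in RHS]mulr5A.
Qed.

Lemma rdet_Gh_minors :
  (\prod_(a < N) (Ah_u M N h - (z a)%:A)) * rdet (Gh h z lam) =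
  \sum_(A : {set 'I_M}) \sum_(B : {set 'I_N} | #|A| == #|B|)
    (-1) ^+ #|A|
    * \prod_(a < N | a \notin B) (Ah_u M N h - (z a)%:A)
    * \prod_(b < M | b \notin A) (Ah_pu M N h - (lam b)%:A)
    * sub_det (\matrix_(i < M, j < N) Ah_x h i j) A B
    * sub_det (\matrix_(i < M, j < N) Ah_p h i j) A B
  :> Ah.
Proof.
rewrite rdet_Gh prod_rat_symbol det_G_symbol => [|a]; last first.
  rewrite /symbol_u /symbol_f /symbol_rat -!mpolyCM mulfV ?mpolyC1 //.
  by rewrite tofrac_eq0 polyXsubC_eq0.
rewrite (raddf_sum sym); apply: eq_bigr => A _.
rewrite (raddf_sum sym); apply: eq_bigr => B _ /=.
apply: esym; apply: normally_ordered_term.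
- exact: sub_det_x_symbol.
- exact: sub_det_symbol_x.
- exact: sub_det_p_symbol.
- by apply: mom_der_sub_det => i j; rewrite mxE mom_derX.
- apply: mom_der_sub_det => i j.
  by rewrite mxE mom_derC commp_pu_x mpolyC0.
Qed.

End Capelli.

Theorem theorem2p1 (R : realType) (M N : nat) (hM : (0 < M)%N) (hN : (0 < N)%N)
    (h : R[i]) (z : 'I_N -> R[i]) (lambda : 'I_M -> R[i]) :
  (\prod_(a < N) (Ah_u M N h - (z a)%:A)) * rdet (Gh h z lambda) =
  \sum_(A : {set 'I_M}) \sum_(B : {set 'I_N} | #|A| == #|B|)
    (-1) ^+ #|A|
    * \prod_(a < N | a \notin B) (Ah_u M N h - (z a)%:A)
    * \prod_(b < M | b \notin A) (Ah_pu M N h - (lambda b)%:A)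
    * sub_det (\matrix_(i < M, j < N) Ah_x h i j) A B
    * sub_det (\matrix_(i < M, j < N) Ah_p h i j) A B
  :> Ah M N h.
Proof. exact: rdet_Gh_minors. Qed.
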